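(* Let $p$ be a prime power, and suppose there is a symmetric design $SBIBD\left(2p+1,p,\frac{p-1}{2}\right)$, with residual design $R$, a $BIBD\left(p+1,2p,p,\frac{p+1}{2},\frac{p-1}{2}\right)$, and derived design $D$, a $BIBD\left(p,2p,p-1,\frac{p-1}{2},\frac{p-3}{2}\right)$. Then for every positive integer $m$ there exists (constructed using $R$ and $D$ as seed designs) a symmetric design $$SBIBD\left(2p\,\frac{p^m-1}{p-1}+1,\; p^m,\; p^{m-1}\,\frac{p-1}{2}\right).$$
   Context: A $BIBD(v,b,r,k,\lambda)$ (balanced incomplete block design) consists of a set of $v$ points and a family of $b$ blocks (subsets of the point set; repeated blocks are allowed) such that every block has exactly $k$ points, every point lies in exactly $r$ blocks, and every two distinct points lie together in exactly $\lambda$ blocks. A symmetric design $SBIBD(v,k,\lambda)$ is a $BIBD(v,b,r,k,\lambda)$ with $b=v$ (hence $r=k$). Given a symmetric design $SBIBD(v,k,\lambda)$ and a block $B_0$, the residual design has as points the $v-k$ points not in $B_0$ and as blocks the sets $B\setminus B_0$ for the blocks $B\ne B_0$; the derived design has as points the $k$ points of $B_0$ and as blocks the sets $B\cap B_0$ for the blocks $B\neq B_0$. All parameters are integers, so the hypothesis forces $p$ to be odd. *)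

(* Defs.v *)
From mathcomp Require Import all_boot.
Set Implicit Arguments.
Unset Strict Implicit.
Unset Printing Implicit Defensive.

Definition prime_power (q : nat) : Prop :=
  exists l n : nat, [/\ prime l, 0 < n & q = l ^ n].

(* The blocks are a family [B] indexed by [I], so repeated blocks are allowed. *)
Definition BIBD (T I : finType) (B : I -> {set T}) (v b r k lambda : nat) : Prop :=
  [/\ #|T| = v,
      #|I| = b,
      forall i : I, #|B i| = k,
      forall x : T, #|[set i | x \in B i]| = r
    & forall x y : T, x != y ->
        #|[set i | (x \in B i) && (y \in B i)]| = lambda].

Definition SBIBD (T I : finType) (B : I -> {set T}) (v k lambda : nat) : Prop :=
  exists r : nat, BIBD B v v r k lambda.

(* The condition B <> B0 on blocks is read on indices. The sets B \ B0 and
   B :&: B0 are taken as subsets of the subtype of points outside, resp. in,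
   B0, which is why membership in B is the only condition written. *)
Definition residual (T I : finType) (B : I -> {set T}) (i0 : I)
    (i : {i : I | i != i0}) : {set {x : T | x \notin B i0}} :=
  [set x | val x \in B (val i)].

Definition derived (T I : finType) (B : I -> {set T}) (i0 : I)
    (i : {i : I | i != i0}) : {set {x : T | x \in B i0}} :=
  [set x | val x \in B (val i)].

(* Main.v *)
From HB Require Import structures.
Require Import Defs.
From mathcomp Require Import all_boot all_algebra all_field.
From mathcomp Require Import zify ring.

(** Let F be the field with p elements, X the set of points of PG(m - 1, p) and
    W a c := chi <a, c>, chi being the quadratic character: W is a weighing
    matrix with p^(m-1) nonzero entries in each row, and on the columns where
    two distinct rows are both nonzero their signs agree exactly half of the
    time.  Replacing the entry 1 of W by the incidence matrix of the residual
    design R, -1 by that of its complementary design and 0 by a zero matrix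
    gives a design on X * points(R).  On F^m, the p parallel hyperplanes
    <c, y> = t are identified with the points of the derived design D, and each
    block of D becomes a union of parallel hyperplanes.  Gluing the two along
    X * (common index set of the blocks of R and D), and adding the block F^m,
    yields the symmetric design.  That a point of R, complemented or not, meets a
    point of D in (p - 1) / 2 blocks is what makes the mixed pairs balanced. *)

Set Implicit Arguments.
Unset Strict Implicit.
Unset Printing Implicit Defensive.

(** * Counting by sums of indicators *)

Lemma cards_sum (T : finType) (P : pred T) :
  #|[set x | P x]| = \sum_x (P x : nat).
Proof. by rewrite cardsE -sum1_card big_mkcond; apply: eq_bigr => x _; rewrite unfold_in; case: (P x). Qed.

Lemma card_sub_set (T : finType) (P Q : pred T) :
  #|[set x : {x | P x} | Q (val x)]| = #|[set x | P x && Q x]|.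
Proof.
rewrite -(card_imset _ val_inj); apply: eq_card => x; rewrite inE.
apply/imsetP/andP => [[y]|[Px Qx]].
  by rewrite inE => Qy ->; split=> //; exact: valP.
by exists (Sub x Px); rewrite ?inE SubK.
Qed.

Lemma cards_pairs (S T : finType) (P : S -> pred T) :
  #|[set z : S * T | P z.1 z.2]| = \sum_s #|[set t | P s t]|.
Proof.
rewrite cards_sum -(pair_bigA _ (fun s t => (P s t : nat))) /=.
by apply: eq_bigr => s _; rewrite cards_sum.
Qed.

Lemma cards_option (T : finType) (P : pred (option T)) :
  #|[set x | P x]| = P None + #|[set x | P (Some x)]|.
Proof.
rewrite !cards_sum (bigD1 None) //=; congr (_ + _).
rewrite (reindex_omap Some id) => [|[x|] //].
by apply: eq_bigl => x; rewrite eqxx.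
Qed.

Lemma cards_sumtype (S T : finType) (P : pred (S + T)) :
  #|[set x | P x]| = #|[set x | P (inl x)]| + #|[set x | P (inr x)]|.
Proof. by rewrite !cards_sum big_sumType. Qed.

(** * Block intersections in a symmetric design, by double counting *)

Section BlockCounts.
Variables (T I : finType) (B : I -> {set T}) (v b r k lambda : nat).
Hypothesis hB : BIBD B v b r k lambda.

Lemma BIBD_flags : v * r = b * k.
Proof.
case: hB => <- <- hk hr _.
rewrite -!sum_nat_const.
transitivity (\sum_x \sum_i (x \in B i : nat)).
  by apply: eq_bigr => x _; rewrite -(hr x) cards_sum.
rewrite exchange_big /=; apply: eq_bigr => i _.
by rewrite -(hk i) -sum1_card [RHS]big_mkcond; apply: eq_bigr => x _; case: (x \in B i).
Qed.

Lemma sum_block_inter (i0 : I) : \sum_i #|B i :&: B i0| = k * r.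
Proof.
case: hB => _ _ hk hr _.
under eq_bigr => i _ do rewrite -sum1_card big_mkcond.
rewrite exchange_big /= -(hk i0) -sum_nat_const [RHS]big_mkcond /=.
apply: eq_bigr => x _; case: ifP => xB; last by rewrite big1 // => i _; rewrite inE xB andbF.
by rewrite -(hr x) cards_sum; apply: eq_bigr => i _; rewrite inE xB andbT; case: (x \in _).
Qed.

(** Count triples (i, x, y) with x and y in both [B i] and [B i0]: for fixed x, the choice y = x
    contributes r and each of the k - 1 others contributes lambda. *)
Lemma sum_block_inter_sqr (i0 : I) :
  \sum_i #|B i :&: B i0| ^ 2 = k * (r + (k - 1) * lambda).
Proof.
case: hB => _ _ hk hr hl.
transitivity (\sum_i \sum_(x in B i0) \sum_(y in B i0) ((x \in B i) && (y \in B i) : nat)).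
  apply: eq_bigr => i _.
  have E : #|B i :&: B i0| = \sum_(x in B i0) (x \in B i : nat).
    rewrite -sum1_card big_mkcond [RHS]big_mkcond; apply: eq_bigr => x _.
    by rewrite inE; do 2![case: (x \in _)].
  rewrite expnS expn1 {1}E big_distrl /=; apply: eq_bigr => x _.
  rewrite E big_distrr /=; apply: eq_bigr => y _.
  by do 2![case: (_ \in _)].
rewrite exchange_big /= -[in RHS](hk i0) -sum_nat_const.
apply: eq_bigr => x xB; rewrite exchange_big /= (bigD1 x) //=; congr (_ + _).
  by rewrite -(hr x) cards_sum; apply: eq_bigr => i _; rewrite andbb.
have -> : #|B i0| - 1 = #|B i0 :\ x| by rewrite (cardsD1 x (B i0)) xB addKn.
rewrite -sum_nat_const; apply: eq_big => [y|y /andP[_ yx]].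
  by rewrite !inE andbC.
by rewrite -(hl x y) 1?eq_sym // cards_sum.
Qed.

End BlockCounts.

(* The squares (|B i :&: B i0| - lambda)^2 sum to 0 over i != i0; in nat this is
   the equality case of 2ab <= a^2 + b^2. *)
Lemma SBIBD_block_inter (T I : finType) (B : I -> {set T}) (v k lambda : nat) :
  BIBD B v v k k lambda -> lambda * (v - 1) = k * (k - 1) ->
  forall i j, i != j -> #|B i :&: B j| = lambda.
Proof.
move=> hB hpar i j ij.
have S1 := sum_block_inter hB j; have S2 := sum_block_inter_sqr hB j.
case: hB => _ hb hk _ _.
move: S1 S2; rewrite (bigD1 j) //= [X in _ -> X = _ -> _](bigD1 j) //= setIid hk.
set s1 := \sum_(i | _) _; set s2 := \sum_(i | _) _ => S1 S2.
have [_ H] := leqif_sum (fun i (_ : i != j) => nat_Cauchy #|B i :&: B j| lambda).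
apply/eqP; move/esym: H.
rewrite -big_distrr /= -big_distrl /= big_split /= -/s1 -/s2 sum_nat_const.
have -> : #|[pred i | i != j]| = v - 1.
  by rewrite subn1 -hb; exact: (cardC1 j).
move=> H; have /forall_inP/(_ i ij) // : [forall (i | i != j), #|B i :&: B j| == lambda].
(* The remaining identity is 2 s1 lambda = s2 + (v - 1) lambda^2, where s1 = k (k - 1) and s2 =
   lambda k (k - 1); [hpar] replaces lambda (v - 1) by k (k - 1). Isolating k = 0 tames the
   truncated k - 1. *)
rewrite H; apply/eqP; have k0 : k = 0 \/ exists k', k = k'.+1 by case: (k) => [|k']; [left|right; exists k'].
case: k0 S1 S2 hpar => [->|[k' ->]]; nia.
Qed.

(** * Residual and derived designs *)

Section ResidualDerived.
Variables (T I : finType) (B : I -> {set T}) (i0 : I) (v k lambda : nat).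
Hypothesis hB : BIBD B v v k k lambda.
Hypothesis hpar : lambda * (v - 1) = k * (k - 1).

Let J := {i : I | i != i0}.

(** The deleted block accounts for 0 when the points lie outside it and for 1 when they lie inside,
    whence the different replication and pair numbers of the two designs. *)
Lemma card_other_blocks (P : pred I) :
  #|[set j : J | P (val j)]| = #|[set i | P i]| - P i0.
Proof.
rewrite card_sub_set [in RHS](cardsD1 i0) inE addKn.
by apply: eq_card => i; rewrite !inE.
Qed.

Lemma residual_BIBD :
  BIBD (@residual T I B i0) (v - k) (v - 1) k (k - lambda) lambda.
Proof.
case: (hB) => hv hb hk hr hl; split.
- have := cardsC (B i0); rewrite card_sig hv hk => <-; rewrite addKn.
  by apply: eq_card => x; rewrite !inE.
- by rewrite card_sig subn1 -hb; exact: (cardC1 i0).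
- move=> [i ii0]; rewrite card_sub_set /= -(hk i) -(SBIBD_block_inter hB hpar ii0) -cardsD.
  by apply: eq_card => x; rewrite !inE.
- move=> x; have := card_other_blocks (fun i => val x \in B i).
  rewrite (negPf (valP x)) subn0 (hr (val x)) => <-.
  by apply: eq_card => i; rewrite !inE.
- move=> x y xy; have := card_other_blocks (fun i => (val x \in B i) && (val y \in B i)).
  rewrite (negPf (valP x)) subn0 hl // => <-.
  by apply: eq_card => i; rewrite !inE.
Qed.

Lemma derived_BIBD :
  BIBD (@derived T I B i0) k (v - 1) (k - 1) lambda (lambda - 1).
Proof.
case: (hB) => hv hb hk hr hl; split.
- by rewrite card_sig -(hk i0); apply: eq_card => x; rewrite !inE.
- by rewrite card_sig subn1 -hb; exact: (cardC1 i0).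
- move=> [i ii0]; rewrite card_sub_set /= -(SBIBD_block_inter hB hpar ii0).
  by apply: eq_card => x; rewrite !inE andbC.
- move=> x; have := card_other_blocks (fun i => val x \in B i).
  by rewrite (valP x) (hr (val x)) => <-; apply: eq_card => i; rewrite !inE.
- move=> x y xy; have := card_other_blocks (fun i => (val x \in B i) && (val y \in B i)).
  by rewrite (valP x) (valP y) hl // => <-; apply: eq_card => i; rewrite !inE.
Qed.

(** The two points are distinct and the deleted block contains only the second, so none of their
    lambda common blocks is lost. *)
Lemma card_residual_derived x y :
  #|[set i | (x \in @residual T I B i0 i) && (y \in @derived T I B i0 i)]| = lambda.
Proof.
case: (hB) => _ _ _ _ hl.
have := card_other_blocks (fun i => (val x \in B i) && (val y \in B i)).
rewrite (negPf (valP x)) subn0 hl => [<-|].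
  by apply: eq_card => i; rewrite !inE.
by apply: contraNneq (valP x) => ->; exact: (valP y).
Qed.

End ResidualDerived.

(** * Complementation and the glued symmetric design *)

Lemma cards_addb2 (T : finType) (P P' : pred T) (n : nat) (s s' : bool) :
  #|T| = 2 * n -> #|[set x | P x]| = n -> #|[set x | P' x]| = n ->
  #|[set x | (P x (+) s) && (P' x (+) s')]| =
  if s == s' then #|[set x | P x && P' x]| else n - #|[set x | P x && P' x]|.
Proof.
move=> hT hP hP'.
(* These are the four cells cut out by [P] and [P']. As both predicates hold on exactly half of [T],
   opposite cells have equal size. *)
pose k a b := \sum_x ((P x == a) && (P' x == b) : nat).
have E a b : #|[set x | (P x (+) a) && (P' x (+) b)]| = k (~~ a) (~~ b).
  by rewrite cards_sum; apply: eq_bigr => x _; case: (P x) (P' x) a b => [] [] [] [].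
have -> : #|[set x | P x && P' x]| = k true true.
  by rewrite cards_sum; apply: eq_bigr => x _; case: (P x) (P' x) => [] [].
have EP : k true true + k true false = n.
  by rewrite -hP cards_sum -big_split; apply: eq_bigr => x _; case: (P x) (P' x) => [] [].
have EP' : k true true + k false true = n.
  by rewrite -hP' cards_sum -big_split; apply: eq_bigr => x _; case: (P x) (P' x) => [] [].
have ET : k true true + k true false + (k false true + k false false) = 2 * n.
  rewrite -hT -sum1_card -!big_split; apply: eq_bigr => x _.
  by case: (P x) (P' x) => [] [].
by rewrite E; case: s s' => [] [] /=; lia.
Qed.

Section Construction.
Variables (RP DP J X V : finType) (R : J -> {set RP}) (D : J -> {set DP}).
Variables (N S : rel X) (phi : X -> V -> DP) (h Q : nat).
Let p := 2 * h + 1.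
Hypothesis hR : BIBD R (p + 1) (2 * p) p (h + 1) h.
Hypothesis hD : BIBD D p (2 * p) (2 * h) h (h - 1).
Hypothesis hRD : forall x y, #|[set i | (x \in R i) && (y \in D i)]| = h.
Hypotheses (h_gt0 : 0 < h) (pQ_gt0 : 0 < p * Q).
Hypothesis card_V : #|V| = p * Q.
Hypothesis card_X : 2 * h * #|X| = p * Q - 1.
Hypothesis row_N : forall a, #|[set c | N a c]| = Q.
Hypothesis col_N : forall c, #|[set a | N a c]| = Q.
(** With Q = p^(m-1) the count is p^(m-2) h. The factor p avoids a division and covers m = 1, where
    [X] is a single point. *)
Hypothesis sign_N : forall a a' b, a != a' ->
  #|[set c | [&& N a c, N a' c & S a c (+) S a' c == b]]| * p = Q * h.
Hypothesis fiber_phi : forall c t, #|[set y | phi c y == t]| = Q.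
Hypothesis sep_phi : forall y y', y != y' -> #|[set c | phi c y != phi c y']| = Q.

(* [N] and [S] are the support of the weighing matrix and the set of its -1
   entries; [phi c y] is the point of [D] attached to the hyperplane of the
   parallel class [c] through [y]. *)
Definition incident (z : X * RP + V) (o : option (X * J)) : bool :=
  match o, z with
  | None, inl _ => false
  | None, inr _ => true
  | Some (c, i), inl (a, x) => N a c && ((x \in R i) (+) S a c)
  | Some (c, i), inr y => phi c y \in D i
  end.

Definition glued_blocks (o : option (X * J)) : {set X * RP + V} :=
  [set z | incident z o].

(** Blocks of [R] contain half of the 2h + 2 points, and points lie in half of the 2p blocks, so
    complementation changes neither block sizes nor degrees. *)
Lemma card_residual_sign i s : #|[set x | (x \in R i) (+) s]| = h + 1.
Proof.
case: hR => hv _ hk _ _; have := cardsC (R i); rewrite hv hk => E.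
case: s; last by rewrite -(hk i); apply: eq_card => x; rewrite inE addbF.
have -> : #|[set x | (x \in R i) (+) true]| = #|~: R i|.
  by apply: eq_card => x; rewrite !inE addbT.
rewrite /p in E; lia.
Qed.

Lemma card_blocks_sign x s : #|[set i | (x \in R i) (+) s]| = p.
Proof.
case: hR => _ hb _ hr _; case: s; last first.
  by rewrite -(hr x); apply: eq_card => i; rewrite !inE addbF.
have := cardsC [set i | x \in R i]; rewrite hr hb => E.
have -> : #|[set i | (x \in R i) (+) true]| = #|~: [set i | x \in R i]|.
  by apply: eq_card => i; rewrite !inE addbT.
lia.
Qed.

Lemma card_blocks_sign2 x x' s s' :
  #|[set i | ((x \in R i) (+) s) && ((x' \in R i) (+) s')]| =
  if s == s' then #|[set i | (x \in R i) && (x' \in R i)]|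
  else p - #|[set i | (x \in R i) && (x' \in R i)]|.
Proof. by case: hR => _ hb _ hr _; apply: cards_addb2. Qed.

(** Of the 2h blocks of [D] through y, exactly h have an index whose block of [R] contains x; the
    other h serve the complement. *)
Lemma card_blocks_sign_derived x y s :
  #|[set i | ((x \in R i) (+) s) && (y \in D i)]| = h.
Proof.
case: s; last by rewrite -(hRD x y); apply: eq_card => i; rewrite !inE addbF.
case: hD => _ _ _ hr _; apply/(@addnI h); rewrite -{1}(hRD x y) addnn -mul2n -(hr y).
rewrite !cards_sum -big_split; apply: eq_bigr => i _ /=.
by case: (x \in _) (y \in _) => [] [].
Qed.

Lemma incidentE z z' : #|[set o | incident z o && incident z' o]| =
  incident z None && incident z' None +
  \sum_c #|[set i | incident z (Some (c, i)) && incident z' (Some (c, i))]|.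
Proof.
rewrite (cards_option (fun o => incident z o && incident z' o)); congr (_ + _).
rewrite -(cards_pairs (fun c i => incident z (Some (c, i)) && incident z' (Some (c, i)))).
by apply: eq_card => -[c i]; rewrite !inE.
Qed.

Lemma cards_guard (T : finType) (g g' : bool) (P P' : pred T) :
  #|[set i | (g && P i) && (g' && P' i)]| = (g && g') * #|[set i | P i && P' i]|.
Proof.
rewrite !cards_sum big_distrr; apply: eq_bigr => i _ /=.
by case: g g' (P i) (P' i) => [] [] [] [].
Qed.

(** A block indexed by (c, i) has Q copies of h + 1 points of [R] and h hyperplanes of Q vectors: Q
    (h + 1) + h Q = p Q. *)
Lemma glued_block_size o : #|glued_blocks o| = p * Q.
Proof.
rewrite (cards_sumtype (fun z => incident z o)); case: o => [[c i]|] /=; last first.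
  by rewrite -card_V [X in X + _]eq_card0 ?add0n => [|z]; rewrite ?inE // cardsT.
have -> : #|[set z | incident (inl z) (Some (c, i))]| = Q * (h + 1).
  transitivity #|[set z : X * RP | N z.1 c && ((z.2 \in R i) (+) S z.1 c)]|.
    by apply: eq_card => -[a x]; rewrite !inE.
  rewrite (cards_pairs (fun a x => N a c && ((x \in R i) (+) S a c))).
  rewrite -(col_N c) cards_sum big_distrl; apply: eq_bigr => a _ /=.
  case: (N a c); first by rewrite mul1n card_residual_sign.
  by rewrite mul0n eq_card0 // => x; rewrite inE.
have -> : #|[set y | phi c y \in D i]| = h * Q.
  case: hD => _ _ hk _ _; rewrite -(hk i) -sum_nat_const -sum1_card.
  rewrite (partition_big (phi c) (mem (D i))) /= => [|y]; last by rewrite inE.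
  apply: eq_bigr => t tD; rewrite sum1_card -(fiber_phi c t).
  by apply: eq_card => y; rewrite unfold_in /= !inE; case: eqP => [->|]; rewrite ?andbF ?tD.
by rewrite /p; nia.
Qed.

Lemma glued_point_degree z : #|[set o | z \in glued_blocks o]| = p * Q.
Proof.
transitivity #|[set o | incident z o && incident z o]|.
  by apply: eq_card => o; rewrite !inE andbb.
rewrite incidentE andbb; case: z => [[a x]|y] /=.
  rewrite add0n mulnC -(row_N a) cards_sum big_distrl; apply: eq_bigr => c _ /=.
  rewrite cards_guard andbb -(card_blocks_sign x (S a c)); congr (_ * _).
  by apply: eq_card => i; rewrite !inE andbb.
(* A vector lies in 2h blocks for each parallel class, and in the added block: 1 + 2h |X| = p Q. *)
rewrite (eq_bigr (fun=> 2 * h)) => [|c _].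
  by rewrite sum_nat_const mulnC card_X /= subnKC.
case: hD => _ _ _ hr _; rewrite -(hr (phi c y)).
by apply: eq_card => i; rewrite !inE andbb.
Qed.

Lemma glued_pair z z' : z != z' -> #|[set o | incident z o && incident z' o]| = Q * h.
Proof.
rewrite incidentE.
(* Mixed pairs: each of the Q columns c with [N a c] contributes h, whatever its sign. *)
have RV a x y : \sum_c #|[set i | incident (inl (a, x)) (Some (c, i)) &&
    incident (inr y) (Some (c, i))]| = Q * h.
  rewrite -(row_N a) cards_sum big_distrl; apply: eq_bigr => c _ /=.
  rewrite -(card_blocks_sign_derived x (phi c y) (S a c)) -[N a c in RHS]andbT.
  exact: (cards_guard (N a c) true (fun i => (x \in R i) (+) S a c) (fun i => phi c y \in D i)).
case: z z' => [[a x]|y] [[a' x']|y'] zz' /=; rewrite ?add0n; last first.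
- case: hD => _ _ _ hr hl.
  have yy' : y != y' by apply: contra_neq zz' => ->.
  (* A class contributes 2h if the vectors share a hyperplane and h - 1 otherwise; Q classes
     separate them. With the added block the total is 1 + 2h (|X| - Q) + Q (h - 1) = Q h, by
     [card_X]. *)
  rewrite (eq_bigr (fun c => (phi c y == phi c y') * (2 * h) +
                             (phi c y != phi c y') * (h - 1))); last first.
    move=> c _; case: eqVneq => E /=; last by rewrite add0n mul1n hl.
    rewrite mul1n addn0 -(hr (phi c y')) E.
    by apply: eq_card => i; rewrite !inE andbb.
  rewrite big_split -!big_distrl /= -!cards_sum sep_phi //.
  have := cardsC [set c | phi c y == phi c y'].
  have -> : #|~: [set c | phi c y == phi c y']| = Q.
    by rewrite -(sep_phi yy'); apply: eq_card => c; rewrite !inE.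
  move: card_X pQ_gt0; rewrite /p; nia.
- rewrite -(RV a' x' y); apply: eq_bigr => c _.
  by apply: eq_card => i; rewrite !inE andbC.
- exact: RV.
rewrite (eq_bigr (fun c => (N a c && N a' c) *
  #|[set i | ((x \in R i) (+) S a c) && ((x' \in R i) (+) S a' c)]|)); last first.
  by move=> c _; rewrite -cards_guard.
have [aa'|aa'] := eqVneq a a'.
  have xx' : x != x' by apply: contra_neq zz' => ->; rewrite aa'.
  case: hR => _ _ _ _ hl; rewrite -aa' -(row_N a) cards_sum big_distrl.
  by apply: eq_bigr => c _ /=; rewrite card_blocks_sign2 eqxx hl // andbb.
(* The points x and x' may coincide here. Columns with equal signs contribute e and the others p -
   e; both kinds are equally many, so e cancels and leaves p times that common number. *)
set e := #|[set i | (x \in R i) && (x' \in R i)]|.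
have ep : e <= p.
  case: hR => _ _ _ hr _; rewrite -(hr x); apply/subset_leq_card/subsetP => i.
  by rewrite !inE => /andP[].
rewrite (eq_bigr (fun c => [&& N a c, N a' c & S a c (+) S a' c == false] * e +
    [&& N a c, N a' c & S a c (+) S a' c == true] * (p - e))); last first.
  move=> c _; rewrite card_blocks_sign2 -/e.
  by case: (N a c) (N a' c) (S a c) (S a' c) => [] [] [] [] /=; lia.
rewrite big_split -!big_distrl /= -!cards_sum.
have := sign_N false aa'; have := sign_N true aa'.
set k1 := #|_|; set k2 := #|_| => E1 E2.
have p0 : 0 < p by rewrite /p; lia.
have E : k1 = k2 by apply/eqP; rewrite -(eqn_pmul2r p0) E1 E2.
by rewrite -E -mulnDr subnKC.
Qed.

Lemma glued_BIBD :
  BIBD glued_blocks (2 * p * #|X| + 1) (2 * p * #|X| + 1) (p * Q) (p * Q) (Q * h).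
Proof.
split.
(* The number of points is (p + 1) |X| + p Q, and p Q = (p - 1) |X| + 1. *)
- case: hR => hv _ _ _ _; rewrite card_sum card_prod hv card_V.
  by move: card_X pQ_gt0; rewrite /p; nia.
- by case: hR => _ hb _ _ _; rewrite card_option card_prod hb addn1 mulnC.
- exact: glued_block_size.
- exact: glued_point_degree.
move=> z z' /glued_pair <-.
by apply: eq_card => o; rewrite !inE.
Qed.

End Construction.

(** * Linear forms over a finite field *)

Import GRing.Theory.
Local Open Scope ring_scope.

(** The fibers of a surjective additive map are translates of one another, hence equally large. *)
Lemma card_additive_fiber (U V : finZmodType) (f : U -> V) :
  {morph f : x y / x + y} -> (forall s, exists x, f x = s) ->
  forall s, (#|[set x | f x == s]| * #|V|)%N = #|U|.
Proof.
move=> fD fsurj.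
have E s t : #|[set x | f x == s]| = #|[set x | f x == t]|.
  have [x0 fx0] := fsurj (t - s).
  rewrite -[LHS](card_imset _ (addIr x0)); apply: eq_card => y; rewrite inE.
  apply/imsetP/eqP => [[x]|fy].
    by rewrite inE => /eqP fx ->; rewrite fD fx fx0 addrC subrK.
  exists (y - x0); last by rewrite subrK.
  by rewrite inE -(inj_eq (addIr (f x0))) -fD subrK fy fx0 addrC subrK.
move=> s; rewrite mulnC -sum_nat_const -[RHS]sum1_card (partition_big f predT) //=.
by apply: eq_bigr => t _; rewrite (E s t) sum1_card cardsE; apply: eq_card.
Qed.

(** Lets a pair of linear forms be treated as one additive map into a finite group. *)
HB.instance Definition _ (U V : finZmodType) := GRing.Zmodule.on (U * V)%type.

Section DotProduct.
Variables (F : finFieldType) (m : nat).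
Notation V := 'rV[F]_m.

Definition dot (u w : V) : F := \sum_i u 0 i * w 0 i.

Lemma dotC u w : dot u w = dot w u.
Proof. by apply: eq_bigr => i _; rewrite mulrC. Qed.

Lemma dotDr u w w' : dot u (w + w') = dot u w + dot u w'.
Proof. by rewrite -big_split; apply: eq_bigr => i _; rewrite mxE mulrDr. Qed.

Lemma dotZr a u w : dot u (a *: w) = a * dot u w.
Proof. by rewrite mulr_sumr; apply: eq_bigr => i _; rewrite mxE mulrCA. Qed.

Lemma dotNr u w : dot u (- w) = - dot u w.
Proof. by rewrite -scaleN1r dotZr mulN1r. Qed.

Lemma dotr0 u : dot u 0 = 0.
Proof. by rewrite -(scale0r 0) dotZr mul0r. Qed.

Lemma dot_delta u j : dot u (delta_mx 0 j) = u 0 j.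
Proof.
rewrite /dot (bigD1 j) //= big1 => [|i /negPf ij]; last by rewrite mxE ij andbF mulr0.
by rewrite mxE !eqxx mulr1 addr0.
Qed.

Lemma row_neq0P (u : V) : u != 0 -> exists i, u 0 i != 0.
Proof.
move=> u0; apply/existsP; apply: contraNT u0; rewrite negb_exists => /forallP u0.
by apply/eqP/rowP => i; rewrite mxE; apply/eqP; move/negPn: (u0 i).
Qed.

Lemma card_row : #|V| = (#|F| ^ m)%N.
Proof. by rewrite card_mx mul1n. Qed.

Lemma card_dot_eq (u : V) s : u != 0 -> (#|[set w | dot u w == s]| * #|F| = #|F| ^ m)%N.
Proof.
move=> /row_neq0P[i ui]; rewrite -card_row; apply: card_additive_fiber; first exact: dotDr.
by move=> t; exists ((t / u 0 i) *: delta_mx 0 i); rewrite dotZr dot_delta divfK.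
Qed.

(** Independence gives a nonzero 2 x 2 minor, so the pair of forms is onto F * F and its fibers are
    equally large. *)
Lemma card_dot2_eq (u u' : V) s t : u != 0 -> (forall a, u' != a *: u) ->
  (#|[set w | (dot u w == s) && (dot u' w == t)]| * #|F| ^ 2 = #|F| ^ m)%N.
Proof.
move=> /row_neq0P[i ui] indep.
have [j dj] : exists j, u 0 i * u' 0 j - u 0 j * u' 0 i != 0.
  apply/existsP; apply: contraT; rewrite negb_exists => /forallP H.
  (* If all minors using column i vanished, u' would be this multiple of u. *)
  have := indep (u' 0 i / u 0 i); rewrite -(negbK (_ == _)) => /negP; case.
  apply/negPn/eqP/rowP => j; rewrite mxE; move/negPn: (H j); rewrite subr_eq0 => /eqP Hj.
  by rewrite mulrAC [_ * u 0 j]mulrC -Hj [u 0 i * _]mulrC mulfK.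
have := @card_additive_fiber V ((F * F)%type : finZmodType) (fun w => (dot u w, dot u' w)).
move=> /(_ _ _ (s, t)); rewrite card_row card_prod mulnn => <-.
- by congr (_ * _)%N; apply: eq_card => w; rewrite !inE xpair_eqE.
- by move=> w w'; rewrite !dotDr.
move=> [a b]; set d := _ - _ in dj.
(* Cramer's rule, for a vector supported on the coordinates i and j. *)
exists (((a * u' 0 j - b * u 0 j) / d) *: delta_mx 0 i
       + ((b * u 0 i - a * u' 0 i) / d) *: delta_mx 0 j).
rewrite !dotDr !dotZr !dot_delta ![_ / d * _]mulrAC -!mulrDl.
by congr (_, _); apply: (canLR (mulfK dj)); rewrite /d; ring.
Qed.
End DotProduct.

(** * Points of projective space *)

Section ProjectivePoints.
Variables (F : finFieldType) (m : nat).
Notation V := 'rV[F]_m.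

Definition line (u : V) : {set V} := [set a *: u | a in [set a : F | a != 0]].
(** The choice made by [pick] depends only on the set [line u], so proportional vectors share their
    representative. *)
Definition line_rep (u : V) : V := odflt u [pick w in line u].

Lemma line_repP u : exists2 a, a != 0 & line_rep u = a *: u.
Proof.
rewrite /line_rep; case: pickP => [w /imsetP[a]|/(_ u)] /=.
  by rewrite inE => a0 ->; exists a.
by case/imsetP; exists 1; rewrite ?inE ?oner_eq0 ?scale1r.
Qed.

Lemma lineZ a u : a != 0 -> line (a *: u) = line u.
Proof.
move=> a0; apply/setP => w; apply/imsetP/imsetP => -[b]; rewrite inE => b0 ->.
  by exists (b * a); rewrite ?inE ?mulf_neq0 ?scalerA.
by exists (b / a); rewrite ?inE ?mulf_neq0 ?invr_eq0 // scalerA divfK.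
Qed.

Lemma line_repZ a u : a != 0 -> line_rep (a *: u) = line_rep u.
Proof.
move=> a0; rewrite /line_rep lineZ //; case: pickP => // /(_ u) /=.
by case/imsetP; exists 1; rewrite ?inE ?oner_eq0 ?scale1r.
Qed.

(** A projective point is encoded as the chosen vector on its line, so that [dot] applies to it
    directly. *)
Definition proj_point := {u : V | (u != 0) && (line_rep u == u)}.

Lemma proj_point_neq0 (c : proj_point) : val c != 0.
Proof. by case/andP: (valP c). Qed.

Lemma line_rep_proj (c : proj_point) : line_rep (val c) = val c.
Proof. by case/andP: (valP c) => _ /eqP. Qed.

Lemma proj_point_indep (c c' : proj_point) a : c != c' -> val c' != a *: val c.
Proof.
apply: contra => /eqP E; apply/eqP/val_inj; have [a0|a0] := eqVneq a 0.
  by case/negP: (proj_point_neq0 c'); rewrite E a0 scale0r.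
by rewrite -(line_rep_proj c') E line_repZ // line_rep_proj.
Qed.

(** Every nonzero vector is a nonzero scalar times a chosen representative, in a unique way. *)
Lemma card_scale_invariant (P : pred V) :
  ~~ P 0 -> (forall a u, a != 0 -> P (a *: u) = P u) ->
  #|[set u | P u]| = ((#|F| - 1) * #|[set c : proj_point | P (val c)]|)%N.
Proof.
move=> P0 PZ; have -> : (#|F| - 1)%N = #|[set a : F | a != 0]|.
  by rewrite cardsE subn1; exact/esym/(cardC1 0).
rewrite -cardsX; set A := setX _ _.
rewrite -(@card_in_imset _ _ (fun z : F * proj_point => z.1 *: val z.2) A).
  apply: eq_card => u; rewrite inE; apply/idP/imsetP => [Pu|[[a c]]]; last first.
    by rewrite !inE /= => /andP[a0 Pc] ->; rewrite PZ.
  have u0 : u != 0 by apply: contraTneq Pu => ->.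
  have [a a0 Eu] := line_repP u.
  have rP : (line_rep u != 0) && (line_rep (line_rep u) == line_rep u).
    by rewrite {1 2}Eu scaler_eq0 negb_or a0 u0 line_repZ /=.
  exists (a^-1, Sub (line_rep u) rP : proj_point).
    by rewrite !inE /= invr_eq0 a0 Eu PZ.
  by rewrite /= Eu scalerA mulVf // scale1r.
move=> [a c] [b d]; rewrite !inE /= => /andP[a0 _] /andP[b0 _] E.
have cd : c = d.
  apply: val_inj; move/(congr1 line_rep): E.
  by rewrite !line_repZ // !line_rep_proj.
rewrite -cd in E *; congr (_, _); apply/eqP; rewrite -subr_eq0.
have /eqP : (a - b) *: val c = 0 by rewrite scalerBl E subrr.
by rewrite scaler_eq0 (negPf (proj_point_neq0 c)) orbF.
Qed.

Lemma card_proj_point : ((#|F| - 1) * #|{: proj_point}|)%N = (#|F| ^ m - 1)%N.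
Proof.
have := @card_scale_invariant (fun u => u != 0); rewrite eqxx => /(_ isT) E.
transitivity #|[set u : V | u != 0]|; last first.
  by rewrite cardsE subn1 -card_row; exact: (cardC1 (0 : V)).
have -> : #|{: proj_point}| = #|[set c : proj_point | val c != 0]|.
  by apply: eq_card => c; rewrite inE proj_point_neq0.
by rewrite -E // => a u a0; rewrite scaler_eq0 (negPf a0).
Qed.

(** With q = |F|, there are q^m - q^(m-1) vectors not orthogonal to u, and each projective point
    accounts for q - 1 of them. *)
Lemma card_proj_dot_neq0 (u : V) : u != 0 -> (0 < m)%N ->
  #|[set c : proj_point | dot u (val c) != 0]| = (#|F| ^ m.-1)%N.
Proof.
move=> u0 m0; have F1 := finNzRing_gt1 F.
have := @card_scale_invariant (fun w => dot u w != 0); rewrite dotr0 eqxx => /(_ isT).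
have E0 := card_dot_eq 0 u0.
have := cardsC [set w | dot u w == 0]; rewrite card_row => EC.
have -> : #|[set w | dot u w != 0]| = #|~: [set w | dot u w == 0]|.
  by apply: eq_card => w; rewrite !inE.
move=> E.
move: E0 EC; rewrite E; last by move=> a w a0; rewrite dotZr mulf_eq0 (negPf a0).
have -> : (#|F| ^ m = #|F| ^ m.-1 * #|F|)%N by rewrite -expnSr prednK.
move=> /eqP; rewrite eqn_pmul2r 1?ltnW // => /eqP -> EC.
apply/eqP; rewrite -(@eqn_pmul2l (#|F| - 1)) ?subn_gt0 //.
by apply/eqP; nia.
Qed.

End ProjectivePoints.

(** * The quadratic character *)

Section QuadraticCharacter.
Variable F : finFieldType.
Hypothesis oddF : odd #|F|.

(** Euler's criterion taken as the definition: on nonzero x the power is 1 or -1, which makes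
    multiplicativity a rule of signs. *)
Definition is_square (x : F) : bool := x ^+ (#|F|.-1)./2 == 1.

Lemma exp_half_card (x : F) : x != 0 ->
  (x ^+ (#|F|.-1)./2 == 1) || (x ^+ (#|F|.-1)./2 == -1).
Proof.
move=> x0; rewrite -eqf_sqr expr1n -exprM muln2.
have -> : ((#|F|.-1)./2).*2 = #|F|.-1.
  by rewrite -[RHS]odd_double_half; move: oddF (finNzRing_gt1 F); case: #|F| => //= n /negPf->.
by apply/eqP/(mulfI x0); rewrite -exprS mulr1 prednK ?expf_card // ltnW ?finNzRing_gt1.
Qed.

Lemma is_squareM (x y : F) : x != 0 -> y != 0 ->
  is_square (x * y) = (is_square x == is_square y).
Proof.
move=> /exp_half_card/orP[]/eqP Ex /exp_half_card/orP[]/eqP Ey;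
  by rewrite /is_square exprMn Ex Ey ?mulr1 ?mul1r ?mulrNN ?mulr1 eqxx // eq_sym; case: eqP.
Qed.

(** With h = (|F| - 1) / 2, the polynomial X^h - 1 has at most h roots, fewer than the 2h nonzero
    elements. *)
Lemma exists_nonsquare : exists2 g : F, g != 0 & ~~ is_square g.
Proof.
have F1 := finNzRing_gt1 F; set h := (#|F|.-1)./2.
have h0 : (0 < h)%N by rewrite /h; move: oddF F1; case: #|F| => // -[|[]].
pose r := enum [pred x : F | is_square x].
pose P : {poly F} := 'X^h - 1%:P.
have szP : size P = h.+1 by rewrite size_XnsubC.
have : (size r < size P)%N.
  apply: max_poly_roots; rewrite ?enum_uniq //; first by rewrite -size_poly_eq0 szP.
  by apply/allP => x; rewrite mem_enum inE /root !hornerE subr_eq0.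
rewrite szP ltnS -cardE => hr.
have /existsP[g /andP[]] : [exists g, (g != 0) && ~~ is_square g]; last by exists g.
apply: contraT; rewrite negb_exists => /forallP H.
have : (#|predC1 (0%R : F)| <= #|[pred x : F | is_square x]|)%N.
  by apply/subset_leq_card/subsetP => x; rewrite !inE => x0; have := H x; rewrite x0 negbK.
rewrite cardC1 => /leq_trans/(_ hr); move: h0; rewrite /h.
by move: (#|F|.-1) => n; lia.
Qed.

Definition sign_pairs (b : bool) : {set F * F} :=
  [set z | [&& z.1 != 0, z.2 != 0 & is_square z.1 (+) is_square z.2 == b]].

(** Multiplying the first coordinate by a nonsquare exchanges agreeing and disagreeing pairs, so
    each kind makes up half of the (|F| - 1)^2 pairs. *)
Lemma card_sign_pairs b : (2 * #|sign_pairs b|)%N = ((#|F| - 1) ^ 2)%N.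
Proof.
have [g g0 gN] := exists_nonsquare.
have le d : (#|sign_pairs d| <= #|sign_pairs (~~ d)|)%N.
  have gI : injective (fun z : F * F => (g * z.1, z.2)).
    by move=> [a c] [a' c'] [/(mulfI g0)-> ->].
  rewrite -(card_imset _ gI); apply/subset_leq_card/subsetP => z /imsetP[[s t]].
  rewrite inE /= => /and3P[s0 t0 /eqP <-] ->.
  rewrite inE /= mulf_neq0 // t0 is_squareM // (negPf gN).
  by do 2![case: is_square].
have E : #|sign_pairs (~~ b)| = #|sign_pairs b|.
  by apply/eqP; rewrite eqn_leq le andbT -{2}[b]negbK le.
rewrite mul2n -addnn -{2}E.
have -> : (#|F| - 1)%N = #|[set a : F | a != 0]|.
  by rewrite cardsE subn1; exact/esym/(cardC1 0).
rewrite expnS expn1 -cardsX -cardsUI [X in (_ + X)%N]eq_card0 ?addn0.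
  apply: eq_card => -[s t]; rewrite !inE /=.
  by do 2![case: (_ == 0)] => //=; case: b {E} => /=; case: (_ (+) _).
move=> [s t]; rewrite !inE /=.
by do 2![case: (_ == 0)] => //=; case: b {E} => /=; case: (_ (+) _).
Qed.

(** Two distinct projective points give independent forms, so each pair of values is taken equally
    often and the balance of [sign_pairs] passes to vectors. Scaling a vector multiplies both
    characters by the same sign, so the count descends to projective points. *)
Lemma card_proj_sign m (c c' : proj_point F m) b : c != c' ->
  (2 * #|[set d : proj_point F m |
          (dot (val c) (val d), dot (val c') (val d)) \in sign_pairs b]| * #|F|
    = #|F| ^ m.-1 * (#|F| - 1))%N.
Proof.
move=> cc'; have F1 := finNzRing_gt1 F.
pose P (w : 'rV[F]_m) := (dot (val c) w, dot (val c') w) \in sign_pairs b.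
have HP : #|[set u | P u]| = ((#|F| - 1) * #|[set d : proj_point F m | P (val d)]|)%N.
  apply: card_scale_invariant => [|a u a0]; first by rewrite /P inE /= dotr0 eqxx.
  rewrite /P !inE /= !dotZr !mulf_eq0 (negPf a0) /=.
  case: eqVneq => //= s0; case: eqVneq => //= t0.
  by rewrite !is_squareM //; do 3![case: is_square].
have HQ : (#|[set u | P u]| * #|F| ^ 2 = #|sign_pairs b| * #|F| ^ m)%N.
  rewrite -sum1_card (partition_big (fun w => (dot (val c) w, dot (val c') w))
    (mem (sign_pairs b))) /=; last by move=> w; rewrite inE.
  rewrite big_distrl -sum_nat_const; apply: eq_bigr => -[s t] st.
  rewrite -(@card_dot2_eq _ _ _ (val c') s t (proj_point_neq0 c)); last first.
    by move=> a; exact: proj_point_indep.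
  rewrite sum1_card; congr (_ * _)%N; apply: eq_card => w.
  rewrite !inE unfold_in /= !inE xpair_eqE /P.
  by case: eqP => [->|]; case: eqP => [->|]; rewrite ?andbF //= st.
have m0 : (0 < m)%N.
  by case: (row_neq0P (proj_point_neq0 c)) => i _; case: m i {c c' cc' P HP HQ} => // -[].
move: HP HQ (card_sign_pairs b).
have -> : (#|F| ^ m = #|F| ^ m.-1 * #|F|)%N by rewrite -expnSr prednK.
rewrite /P; set M := #|[set d : proj_point F m | _]|; move=> -> HQ HN.
apply/eqP; rewrite -(@eqn_pmul2r #|F|) 1?ltnW // -(@eqn_pmul2l (#|F| - 1)) ?subn_gt0 //.
by apply/eqP; nia.
Qed.

End QuadraticCharacter.

Local Close Scope ring_scope.

(** * Assembling the design *)

Lemma card_eq_bij (S T : finType) : #|S| = #|T| -> {f : S -> T | bijective f}.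
Proof.
move=> E; exists (fun x => enum_val (cast_ord E (enum_rank x))).
exists (fun y => enum_val (cast_ord (esym E) (enum_rank y))) => x.
  by rewrite enum_valK cast_ordK enum_rankK.
by rewrite enum_valK cast_ordKV enum_rankK.
Qed.

Theorem theorem6 (p : nat) (hp : prime_power p) (hodd : odd p)
    (T I : finType) (B : I -> {set T}) (i0 : I)
    (hB : SBIBD B (2 * p + 1) p ((p - 1) %/ 2)) :
  [/\ BIBD (@residual T I B i0)
        (p + 1) (2 * p) p ((p + 1) %/ 2) ((p - 1) %/ 2),
      BIBD (@derived T I B i0)
        p (2 * p) (p - 1) ((p - 1) %/ 2) ((p - 3) %/ 2)
    & forall m : nat, 0 < m ->
        exists (T' I' : finType) (B' : I' -> {set T'}),
          SBIBD B' (2 * p * ((p ^ m - 1) %/ (p - 1)) + 1)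
                   (p ^ m) (p ^ (m - 1) * ((p - 1) %/ 2))].
Proof.
have [l [n [pr_l n_gt0 pE]]] := hp.
have p_gt1 : 1 < p by rewrite pE -(exp1n n) ltn_exp2r // prime_gt1.
have [h ph] : exists h, p = 2 * h + 1.
  by exists p./2; rewrite -[LHS]odd_double_half hodd -mul2n addnC.
have h_gt0 : 0 < h by lia.
have p1 : p - 1 = 2 * h by lia.
have -> : (p + 1) %/ 2 = h + 1 by lia.
have -> : (p - 3) %/ 2 = h - 1 by lia.
have hE : (p - 1) %/ 2 = h by lia.
rewrite hE in hB *.
have {}hB : BIBD B (2 * p + 1) (2 * p + 1) p p h.
  (* Counting flags gives v r = v k, hence r = k. *)
  case: hB => r hr; have /eqP := BIBD_flags hr; rewrite eqn_pmul2l ?addn1 // => /eqP rp.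
  by move: hr; rewrite rp addn1.
have hpar : h * (2 * p + 1 - 1) = p * (p - 1) by nia.
have hR : BIBD (@residual T I B i0) (p + 1) (2 * p) p (h + 1) h.
  have := residual_BIBD i0 hB hpar.
  by congr (BIBD _ _ _ _ _ _); lia.
have hD : BIBD (@derived T I B i0) p (2 * p) (p - 1) h (h - 1).
  by have := derived_BIBD i0 hB hpar; congr (BIBD _ _ _ _ _ _); lia.
split=> // m m_gt0.
have [F _ cardF] := PrimePowerField pr_l n_gt0; rewrite -pE in cardF.
have oddF : odd #|F| by rewrite cardF.
(* Any bijection will do: only the fibers of the labelling of hyperplanes and the separation of
   vectors enter the gluing. *)
have [f [g fK gK]] : {f : F -> {x | x \in B i0} | bijective f}.
  by apply: card_eq_bij; case: hD => ->.
pose X := proj_point F m.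
pose N (a c : X) := dot (val a) (val c) != 0%R.
(* The complemented entries are the squares, so the matrix is -chi rather than chi; agreement of
   signs is unaffected. *)
pose S (a c : X) := is_square (dot (val a) (val c)).
pose phi (c : X) (y : 'rV[F]_m) := f (dot (val c) y).
have pm : p ^ m = p * p ^ (m - 1) by rewrite -expnS subn1 prednK.
have cX : (p - 1) * #|{: X}| = p ^ m - 1 by rewrite -cardF card_proj_point.
have -> : (p ^ m - 1) %/ (p - 1) = #|{: X}| by rewrite -cX mulKn // subn_gt0.
exists (X * {x | x \notin B i0} + 'rV[F]_m)%type, (option (X * {i | i != i0}))%type.
exists (glued_blocks (@residual T I B i0) (@derived T I B i0) N S phi), (p ^ m).
have row_N a : #|[set c | N a c]| = p ^ (m - 1).
  by rewrite subn1 -cardF; apply: card_proj_dot_neq0 => //; exact: proj_point_neq0.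
rewrite pm.
have := @glued_BIBD _ _ _ _ _ (@residual T I B i0) (@derived T I B i0) N S phi h (p ^ (m - 1)).
rewrite -ph; apply=> //.
- by rewrite -p1.
- exact: card_residual_derived hB.
- by rewrite muln_gt0 expn_gt0 (ltnW p_gt1).
- by rewrite -pm -cardF card_row.
- by rewrite -p1 -pm -cX.
- by move=> c; rewrite -(row_N c); apply: eq_card => a; rewrite !inE /N dotC.
- move=> a a' b aa'; have := card_proj_sign oddF b aa'.
  rewrite cardF -subn1 => E.
  have -> : #|[set c | [&& N a c, N a' c & S a c (+) S a' c == b]]| =
    #|[set d : X | (dot (val a) (val d), dot (val a') (val d)) \in sign_pairs F b]|.
    by apply: eq_card => c; rewrite !inE.
  by move: E; set k := #|_|; nia.
- move=> c t; have := card_dot_eq (g t) (proj_point_neq0 c).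
  rewrite cardF pm mulnC => /eqP; rewrite eqn_pmul2l 1?ltnW // => /eqP <-.
  by apply: eq_card => y; rewrite !inE /phi -(can_eq gK) fK.
(* The class c separates y and y' exactly when c is not orthogonal to y - y'. *)
move=> y y' yy'; have u0 : (y - y')%R != 0%R by rewrite subr_eq0.
rewrite subn1 -cardF -(card_proj_dot_neq0 u0 m_gt0); apply: eq_card => c.
by rewrite !inE /phi (can_eq fK) [dot (y - y') _]dotC dotDr dotNr subr_eq0.
Qed.
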